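(* Two arbitrary finite abelian groups $G$ and $G'$ are isomorphic if and only if they have the same number of subgroups of any exponent, i.e., $|\mathcal{E}_d(G)|=|\mathcal{E}_d(G')|$ for every positive integer $d$.
   Context: For a finite abelian group $G$ and a positive integer $d$, $\mathcal{E}_d(G)=\{H\leq G : \exp(H)=d\}$ is the set of subgroups of $G$ whose exponent is exactly $d$. *)

(* Defs.v *)
From mathcomp Require Import all_boot all_fingroup all_solvable.
Set Implicit Arguments.
Unset Strict Implicit.
Unset Printing Implicit Defensive.

Definition subgroups_exp (gT : finGroupType) (d : nat) (G : {group gT}) :
    {set {group gT}} :=
  [set H : {group gT} in subgroups G | exponent H == d].

(* Main.v *)
Require Import Defs.
From mathcomp Require Import all_boot all_fingroup all_solvable.

(** Write G[n] for the subgroup of the elements of G whose order divides n,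
    which is ['Ldiv_n(G)]. The subgroups of G[n] are the subgroups of G whose
    exponent divides n, so summing the hypothesis over the divisors of n shows
    that G[n] and G'[n] have equally many subgroups, for every n > 0
    ([card_subgroups_Ldiv]).

    Decompose G and G' as direct products of cyclic groups of orders s_0, s_1,
    ... and t_0, t_1, ..., each order dividing the one before, both lists being
    padded with 1 to a common length ([abelian_cycle_family]). Then G[n] is the
    product of cyclic groups of orders gcd(s_i, n) ([Ldiv_bigdprod_cycle]). It
    suffices to prove gcd(s_i, p^k) = gcd(t_i, p^k) for all i and all prime
    powers p^k, which is done by induction on k.

    Suppose this holds for k. Going to k.+1 multiplies gcd(s_i, p^k) by p
    exactly when p^(k.+1) divides s_i, that is for i in an initial segment of
    the indices, and likewise for t. Two initial segments are nested, so one
    of the two lists of gcds divides the other term by term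
    ([gcdn_pfactorS_comparable]). Hence one of G[p^(k.+1)] and G'[p^(k.+1)] is
    isomorphic to a subgroup K of the other one, B. If K were proper, B would
    have more subgroups than K, namely B itself; so K = B, and comparing orders
    makes the two lists of gcds equal ([eq_order_dvdn_card_subgroups]). *)

Set Implicit Arguments.
Unset Strict Implicit.
Unset Printing Implicit Defensive.

(** * Divisibility of sequences of natural numbers *)

Lemma prod_dvdn_inj (I : eqType) (r : seq I) (s t : I -> nat) :
    {in r, forall i, s i %| t i} -> {in r, forall i, 0 < t i} ->
    \prod_(i <- r) s i = \prod_(i <- r) t i ->
  {in r, forall i, s i = t i}.
Proof.
elim: r => // i r IHr st t_gt0; rewrite !big_cons => eq_st.
have str : {in r, forall j, s j %| t j}.
  by move=> j jr; rewrite st // in_cons jr orbT.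
have tr_gt0 : {in r, forall j, 0 < t j}.
  by move=> j jr; rewrite t_gt0 // in_cons jr orbT.
have T_gt0 : 0 < \prod_(j <- r) t j.
  by rewrite big_seq prodn_cond_gt0.
have ST : \prod_(j <- r) s j %| \prod_(j <- r) t j.
  rewrite big_seq [X in _ %| X]big_seq.
  by elim/big_rec2: _ => // j a b jr ab; rewrite dvdn_mul ?str.
have ti_gt0 := t_gt0 i (mem_head _ _); have sti := st i (mem_head _ _).
have eq_i : s i = t i.
  apply/eqP; rewrite eqn_dvd sti -(dvdn_pmul2r T_gt0) -eq_st.
  by rewrite dvdn_mul.
move=> j; rewrite in_cons => /predU1P[-> // | jr]; apply: IHr => //.
by move/eqP: eq_st; rewrite eq_i eqn_pmul2l // => /eqP.
Qed.

(** The indices i with p^(k.+1) %| s i form an initial segment because s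
    decreases for divisibility; those for s and for t are therefore nested, and
    the inclusion decides which alternative holds. *)
Lemma gcdn_pfactorS_comparable (s t : nat -> nat) p k m :
    prime p -> {homo s : i j / i <= j >-> j %| i} ->
    {homo t : i j / i <= j >-> j %| i} ->
    (forall i, i < m -> gcdn (s i) (p ^ k) = gcdn (t i) (p ^ k)) ->
  (forall i, i < m -> gcdn (s i) (p ^ k.+1) %| gcdn (t i) (p ^ k.+1))
  \/ (forall i, i < m -> gcdn (t i) (p ^ k.+1) %| gcdn (s i) (p ^ k.+1)).
Proof.
move=> p_pr.
have step u v : (forall i, i < m -> gcdn (u i) (p ^ k) = gcdn (v i) (p ^ k)) ->
    (forall i, i < m -> p ^ k.+1 %| u i -> p ^ k.+1 %| v i) ->
  forall i, i < m -> gcdn (u i) (p ^ k.+1) %| gcdn (v i) (p ^ k.+1).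
  move=> eq_k uv i lt_im.
  have [pu | pu] := boolP (p ^ k.+1 %| u i).
    by rewrite (gcdn_idPr pu) (gcdn_idPr (uv i lt_im pu)).
  (* Below p^(k.+1) the gcd is at most p^k, where u and v agree. *)
  have /(dvdn_pfactor _ _ p_pr)[j le_jk gj] := dvdn_gcdr (u i) (p ^ k.+1).
  have {}le_jk : j <= k.
    rewrite -ltnS ltn_neqAle le_jk andbT; apply: contra pu => /eqP jk.
    by rewrite -jk -gj dvdn_gcdl.
  rewrite dvdn_gcd dvdn_gcdr andbT.
  apply: dvdn_trans (dvdn_gcdl (v i) (p ^ k)).
  by rewrite -eq_k // dvdn_gcd dvdn_gcdl gj dvdn_exp2l.
move=> s_decr t_decr eq_k.
case: (boolP [forall i : 'I_m, (p ^ k.+1 %| s i) ==> (p ^ k.+1 %| t i)]).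
  by move/forallP=> st; left; apply: step => // i lt_im;
     apply/implyP; apply: (st (Ordinal lt_im)).
(* An index i0 in the segment of s but not in that of t bounds the latter. *)
case/forallPn=> i0; rewrite negb_imply => /andP[ps pt].
right; apply: step => [i lt_im | i lt_im pti]; first by rewrite eq_k.
case: (leqP i i0) => [le_i | lt_i].
  exact: dvdn_trans ps (s_decr _ _ le_i).
by case/negP: pt; apply: dvdn_trans pti (t_decr _ _ (ltnW lt_i)).
Qed.

(** The number gcdn s (p ^ k) with k the p-adic valuation of s is the p-part
    of s, so these gcds determine every p-part. *)
Lemma eqn_gcdn_pfactor s t : 0 < s -> 0 < t ->
  (forall p k, prime p -> gcdn s (p ^ k) = gcdn t (p ^ k)) -> s = t.
Proof.
have half u v : 0 < u -> 0 < v ->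
    (forall p k, prime p -> gcdn u (p ^ k) = gcdn v (p ^ k)) -> u %| v.
  move=> u_gt0 v_gt0 eq_uv; apply/dvdn_partP => // p.
  rewrite mem_primes p_part => /andP[p_pr _].
  by apply/gcdn_idPr; rewrite -eq_uv //; apply/gcdn_idPr; rewrite pfactor_dvdnn.
move=> s_gt0 t_gt0 eq_st; apply/eqP; rewrite eqn_dvd !half // => p k p_pr.
by rewrite eq_st.
Qed.

Local Open Scope group_scope.

(** * Counting subgroups *)

Section CountingSubgroups.

Variables gT rT : finGroupType.
Implicit Types (G K : {group gT}) (H : {group rT}) (P : pred nat).

(** An isomorphism maps distinct subgroups to distinct subgroups of the same
    exponent. The predicate P covers both the count of all subgroups and the
    count for one given exponent. *)
Lemma leq_card_subgroups_isog P G H : G \isog H ->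
  #|[set K in subgroups G | P (exponent K)]|
    <= #|[set K in subgroups H | P (exponent K)]|.
Proof.
case/isogP=> f injf fG.
have sub K : K \in [set K in subgroups G | P (exponent K)] -> K \subset G.
  by rewrite !inE => /andP[].
have inj_im : {in [set K in subgroups G | P (exponent K)] &,
                 injective (fun K => (f @* K)%G)}.
  move=> K L /sub sKG /sub sLG eqKL; apply: val_inj => /=.
  by apply: (injm_morphim_inj injf sKG sLG); apply: (congr1 val eqKL).
rewrite -(card_in_imset inj_im); apply: subset_leq_card.
apply/subsetP=> _ /imsetP[K KP ->].
have sKG := sub K KP; move: KP; rewrite !inE => /andP[_ PK].
by rewrite -fG morphimS //= (exponent_injm injf sKG).
Qed.

(** A subgroup of G lies in 'Ldiv_n(G) exactly when its exponent divides n;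
    the sum sorts these subgroups by exponent. *)
Lemma card_subgroups_Ldiv G n (abG : abelian G) : 0 < n ->
  #|subgroups (Group (group_Ldiv n abG))|
    = \sum_(d < n.+1 | d %| n) #|subgroups_exp d G|.
Proof.
move=> n_gt0.
have -> : subgroups (Group (group_Ldiv n abG))
        = [set K in subgroups G | exponent K %| n].
  apply/setP=> K; rewrite !inE /= subsetI; apply: andb_id2l => _.
  exact: sub_LdivT.
(* As exponent K %| n and n > 0, exponent K < n.+1, so inord loses nothing. *)
rewrite -sum1_card.
rewrite (partition_big (fun K => inord (exponent K) : 'I_n.+1)
           (fun d : 'I_n.+1 => d %| n)) => [|K]; last first.
  by rewrite inE => /andP[_ eKn]; rewrite inordK // ltnS dvdn_leq.
apply: eq_bigr => d d_n; rewrite -sum1_card; apply: eq_bigl => K.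
rewrite /subgroups_exp !inE -andbA; apply: andb_id2l => _.
apply/andP/eqP => [[eKn /eqP <-] | ->].
  by rewrite inordK // ltnS dvdn_leq.
by rewrite inord_val.
Qed.

End CountingSubgroups.

Lemma card_subgroups_isog (gT rT : finGroupType) (P : pred nat)
    (G : {group gT}) (H : {group rT}) : G \isog H ->
  #|[set K in subgroups G | P (exponent K)]|
    = #|[set K in subgroups H | P (exponent K)]|.
Proof.
move=> isoGH; apply/eqP; rewrite eqn_leq !leq_card_subgroups_isog //.
by rewrite isog_sym.
Qed.

(** Every subgroup of K is one of B, and B is a subgroup of B that is not
    contained in K unless K = B. Counting subgroups thus rules out that A
    embeds properly into B. *)
Lemma subgroups_eq_card (gT rT : finGroupType) (A : {group rT})
    (K B : {group gT}) :
    A \isog K -> K \subset B -> #|subgroups A| = #|subgroups B| ->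
  K = B :> {set _}.
Proof.
move=> isoAK sKB eqAB; apply/eqP; rewrite eqEsubset sKB /=.
have eqAK : #|subgroups A| = #|subgroups K|.
  have := card_subgroups_isog predT isoAK; rewrite !setIdE.
  by rewrite ![_ :&: _](setIidPl _) //; apply/subsetP=> L; rewrite inE.
have sSKB : subgroups K \subset subgroups B.
  by apply/subsetP=> L; rewrite !inE => sLK; apply: subset_trans sKB.
have /eqP eqKB : subgroups K == subgroups B.
  by rewrite eqEcard sSKB -eqAB eqAK leqnn.
have : B \in subgroups K by rewrite eqKB inE.
by rewrite inE.
Qed.

(** * Direct products of cyclic groups *)

Section CyclicDecompositions.

Variables (gT : finGroupType) (I : Type).
Implicit Types (G : {group gT}) (r : seq I) (x : I -> gT).

Lemma sub_bigdprod_cycle r x e G :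
    \big[dprod/1]_(i <- r) <[x i]> = G ->
  exists2 K : {group gT}, K \subset G &
    \big[dprod/1]_(i <- r) <[x i ^+ e i]> = K.
Proof.
elim: r G => [|i r IHr] G; first by rewrite !big_nil => <-; exists 1%G.
rewrite !big_cons => /dprodP[[A B Adef Bdef] ABG cAB tiAB].
rewrite Bdef Adef in ABG cAB tiAB.
have [L sLB Ldef] := IHr B Bdef.
have sxA : <[x i ^+ e i]> \subset A by rewrite -Adef cycleX.
have dxL : <[x i ^+ e i]> \x L = <[x i ^+ e i]> <*> L.
  apply: dprodEY.
    by apply: subset_trans sLB _; apply: subset_trans cAB (centS sxA).
  by apply/trivgP; rewrite -tiAB setISS.
exists (<[x i ^+ e i]> <*> L)%G; last by rewrite Ldef.
by rewrite /= join_subG -ABG (subset_trans sxA (mulG_subl _ _))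
           (subset_trans sLB (mulG_subr _ _)).
Qed.

(** With o the order of x, the power x ^+ j is killed by n iff o %| j * n, that
    is iff o %/ gcdn o n %| j. *)
Lemma Ldiv_cycle n (x : gT) :
  'Ldiv_n(<[x]>) = <[x ^+ (#[x] %/ gcdn #[x] n)]>.
Proof.
have [o_gt0 g_gt0] : 0 < #[x] /\ 0 < gcdn #[x] n.
  by rewrite gcdn_gt0 !order_gt0.
have [k kn] : exists k, n = (k * gcdn #[x] n)%N.
  by have /dvdnP := dvdn_gcdr #[x] n.
apply/eqP; rewrite eqEsubset; apply/andP; split; last first.
  have /= -> := cycle_subG _ (Group (group_Ldiv n (cycle_abelian x))).
  rewrite !inE mem_cycle /= -expgM -order_dvdn {2}kn.
  by rewrite mulnCA divnK ?dvdn_gcdl // dvdn_mull.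
apply/subsetP=> _ /setIP[/cycleP[j ->]]; rewrite inE -expgM -order_dvdn => ojn.
suff /dvdnP[q ->] : #[x] %/ gcdn #[x] n %| j by rewrite mulnC expgM mem_cycle.
rewrite -(@dvdn_pmul2r (gcdn #[x] n)) // divnK ?dvdn_gcdl //.
by rewrite muln_gcdr dvdn_gcd ojn dvdn_mull.
Qed.

(** For a in A and b in B, (a * b) ^+ n = 1 makes a ^+ n the inverse of b ^+ n,
    an element of A :&: B = 1; so n kills both a and b. *)
Lemma Ldiv_dprod n (A B : {set gT}) G : abelian G ->
  A \x B = G -> 'Ldiv_n(A) \x 'Ldiv_n(B) = 'Ldiv_n(G).
Proof.
move=> abG /dprodP[[{}A {}B -> ->] ABG cAB tiAB].
have [sAG sBG] : A \subset G /\ B \subset G.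
  by rewrite -ABG mulG_subl mulG_subr.
have [abA abB] := (abelianS sAG abG, abelianS sBG abG).
pose An := Group (group_Ldiv n abA); pose Bn := Group (group_Ldiv n abB).
have := @dprodE _ An Bn => -> /=; last first.
- by apply/(@trivgP _ (An :&: Bn)%G); rewrite -tiAB setISS ?subsetIl.
- rewrite (subset_trans (subsetIl _ _)) // (subset_trans cAB) //.
  by rewrite centS ?subsetIl.
apply/eqP; rewrite eqEsubset; apply/andP; split.
  have /= <- := mulGid (Group (group_Ldiv n abG)).
  by rewrite mulgSS // setSI.
apply/subsetP=> g /setIP[]; rewrite -{1}ABG => /mulsgP[a b Aa Bb ->].
have cab : commute a b by apply/commute_sym/(centsP cAB).
rewrite inE expgMn // => /eqP abn1.
have an1 : a ^+ n = 1.
  apply/set1gP; rewrite -tiAB inE groupX //=.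
  by rewrite -(mulgK (b ^+ n) (a ^+ n)) abn1 mul1g groupV groupX.
rewrite an1 mul1g in abn1.
by rewrite mem_mulg // !inE ?Aa ?Bb ?an1 ?abn1 /=.
Qed.

Lemma Ldiv_bigdprod_cycle n r x G : abelian G ->
    \big[dprod/1]_(i <- r) <[x i]> = G ->
  \big[dprod/1]_(i <- r) <[x i ^+ (#[x i] %/ gcdn #[x i] n)]> = 'Ldiv_n(G).
Proof.
elim: r G => [|i r IHr] G abG; rewrite ?big_nil ?big_cons.
  move=> <-; apply/eqP; rewrite eq_sym eqEsubset subsetIl.
  by rewrite sub1set !inE expg1n eqxx.
move=> dG; have [[A B _ Bdef] _ _ _] := dprodP dG.
rewrite Bdef in dG; have [_ ABG _ _] := dprodP dG.
have abB : abelian B by apply: abelianS abG; rewrite -ABG mulG_subr.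
by rewrite (IHr B abB Bdef) -Ldiv_cycle; apply: Ldiv_dprod.
Qed.

End CyclicDecompositions.

Lemma order_expg_divn (gT : finGroupType) (x : gT) d :
  d %| #[x] -> #[x ^+ (#[x] %/ d)] = d.
Proof.
move=> d_x; rewrite orderXdiv ?dvdn_divl ?dvdn_div //.
by rewrite divnA // mulKn.
Qed.

Lemma isog_bigdprod_cycle (gT rT : finGroupType) (I : eqType) (r : seq I)
    (x : I -> gT) (y : I -> rT) (G : {group gT}) (H : {group rT}) :
    \big[dprod/1]_(i <- r) <[x i]> = G -> \big[dprod/1]_(i <- r) <[y i]> = H ->
    {in r, forall i, #[x i] = #[y i]} -> G \isog H.
Proof.
elim: r G H => [|i r IHr] G H; rewrite ?big_nil ?big_cons.
  move=> G1 H1 _; rewrite -(group_inj G1) -(group_inj H1).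
  by rewrite isog_cyclic_card ?cyclic1 // !cards1.
move=> dG dH eqxy; have [[_ B _ Bdef] _ _ _] := dprodP dG.
have [[_ D _ Ddef] _ _ _] := dprodP dH.
rewrite Bdef in dG; rewrite Ddef in dH; apply: (isog_dprod dG dH).
  rewrite isog_cyclic_card ?cycle_cyclic //=.
  by rewrite -!orderE eqxy ?mem_head.
by apply: IHr => // j jr; apply: eqxy; rewrite in_cons jr orbT.
Qed.

(** The divisibilities provide inside B a product K of cyclic groups with the
    orders of the factors of A, hence a copy of A; the equal numbers of
    subgroups force K = B, so the products of the two lists of orders agree,
    and so do the lists. *)
Lemma eq_order_dvdn_card_subgroups (gT rT : finGroupType) (I : eqType)
    (r : seq I) (x : I -> gT) (y : I -> rT) (A : {group gT}) (B : {group rT}) :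
    \big[dprod/1]_(i <- r) <[x i]> = A -> \big[dprod/1]_(i <- r) <[y i]> = B ->
    {in r, forall i, #[x i] %| #[y i]} -> #|subgroups A| = #|subgroups B| ->
  {in r, forall i, #[x i] = #[y i]}.
Proof.
move=> dA dB xy eqAB; apply: prod_dvdn_inj => //.
have [K sKB dK] := sub_bigdprod_cycle (fun i => #[y i] %/ #[x i]) dB.
have isoAK : A \isog K.
  by apply: isog_bigdprod_cycle dA dK _ => i /xy xyi; rewrite order_expg_divn.
have eqKB := subgroups_eq_card isoAK sKB eqAB.
by rewrite (bigdprod_card dA) (bigdprod_card dB) (card_isog isoAK) eqKB.
Qed.

(** The family is infinite and eventually trivial, so that decompositions of
    two groups can be cut off at a common length m. *)
Lemma abelian_cycle_family (gT : finGroupType) (G : {group gT}) :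
    abelian G ->
  exists n (x : nat -> gT),
    {homo (fun i => #[x i]) : i j / i <= j >-> j %| i}
    /\ forall m, n <= m -> \big[dprod/1]_(0 <= i < m) <[x i]> = G.
Proof.
case/abelian_structure=> b dG ob.
exists (size b), (nth 1 b); split=> [i j le_ij | m le_bm]; last first.
  rewrite (big_cat_nat (n := size b)) //= [X in _ \x X]big1_seq => [|i].
    by rewrite dprodg1 -(big_nth 1 xpredT (fun x => <[x]>)).
  rewrite mem_index_iota => /andP[_ /andP[bi _]].
  by rewrite nth_default ?cycle1.
have [ltj | gej] := ltnP j (size b); last first.
  by rewrite [X in #[X] %| _]nth_default ?order1.
have lti := leq_ltn_trans le_ij ltj.
rewrite -!(nth_map 1 0) // ob.
apply: (sorted_leq_nth (leT := fun m n => n %| m)) => //.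
- by move=> u v w vu wu; apply: dvdn_trans wu vu.
- exact: abelian_type_dvdn_sorted.
- by rewrite inE -ob size_map.
- by rewrite inE -ob size_map.
Qed.

Theorem corollary2p3 (gT gT' : finGroupType)
    (G : {group gT}) (G' : {group gT'})
    (abG : abelian G) (abG' : abelian G') :
  G \isog G' <->
  (forall d : nat, 0 < d -> #|subgroups_exp d G| = #|subgroups_exp d G'|).
Proof.
split=> [isoG d _ | eqE]; first exact: (card_subgroups_isog (pred1 d) isoG).
have [n [x [x_decr dG]]] := abelian_cycle_family abG.
have [n' [y [y_decr dG']]] := abelian_cycle_family abG'.
pose m := maxn n n'.
have {}dG := dG m (leq_maxl _ _); have {}dG' := dG' m (leq_maxr _ _).
apply: (isog_bigdprod_cycle dG dG') => i; rewrite mem_index_iota /= => lt_im.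
apply: eqn_gcdn_pfactor => // p k p_pr.
elim: k i lt_im => [|k IHk] i lt_im; first by rewrite expn0 !gcdn1.
have q_gt0 : 0 < (p ^ k.+1)%N by rewrite expn_gt0 prime_gt0.
set q := (p ^ k.+1)%N in q_gt0 *.
have eqL : #|subgroups (Group (group_Ldiv q abG))|
         = #|subgroups (Group (group_Ldiv q abG'))|.
  rewrite !card_subgroups_Ldiv //; apply: eq_bigr => d d_q.
  by rewrite eqE // (dvdn_gt0 q_gt0).
have dL := Ldiv_bigdprod_cycle q abG dG.
have dL' := Ldiv_bigdprod_cycle q abG' dG'.
have ox j : #[x j ^+ (#[x j] %/ gcdn #[x j] q)] = gcdn #[x j] q.
  by rewrite order_expg_divn ?dvdn_gcdl.
have oy j : #[y j ^+ (#[y j] %/ gcdn #[y j] q)] = gcdn #[y j] q.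
  by rewrite order_expg_divn ?dvdn_gcdl.
have i_m : i \in index_iota 0 m by rewrite mem_index_iota.
rewrite -ox -oy.
have [xy | yx] := gcdn_pfactorS_comparable p_pr x_decr y_decr IHk.
  apply: (eq_order_dvdn_card_subgroups (A := Group (group_Ldiv q abG))
            (B := Group (group_Ldiv q abG')) dL dL' _ eqL i_m) => j.
  by rewrite mem_index_iota ox oy; apply: xy.
apply/esym.
apply: (eq_order_dvdn_card_subgroups (A := Group (group_Ldiv q abG'))
          (B := Group (group_Ldiv q abG)) dL' dL _ (esym eqL) i_m) => j.
by rewrite mem_index_iota ox oy; apply: yx.
Qed.
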